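(* For all graphs $G_1$ and $G_2$, $\chi_i(G_1 \cup G_2) \leq \chi_i(G_1) + \chi_i(G_2)$.
   Context: $G_1\cup G_2$ is the graph with vertex set $V(G_1)\cup V(G_2)$ and edge set $E(G_1)\cup E(G_2)$. For a graph $G$, let $D(G)$ be the digraph obtained by replacing each edge $uv$ by the two opposite arcs $uv$ and $vu$, with arc set $A(G)$. Two distinct arcs $uv$ and $xy$ are adjacent if $u=x$, or $v=x$, or $y=u$. An incidence coloring is a map $\sigma: A(G)\to C$ assigning distinct colors to adjacent arcs; the incidence chromatic number $\chi_i(G)$ is the minimum $|C|$ over all incidence colorings. *)

(* Defs.v *)
From mathcomp Require Import all_boot.

Set Implicit Arguments.
Unset Strict Implicit.
Unset Printing Implicit Defensive.

(* Finite simple graphs whose vertices lie in a common finite universe [T], so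
   that two graphs may overlap arbitrarily. *)
Record graph (T : finType) := Graph {
  vertices : {set T};
  edges : {set {set T}};
  edgesP : forall e, e \in edges -> (e \subset vertices) && (#|e| == 2)
}.

Section Graph.
Variable T : finType.
Implicit Types G : graph T.

Lemma graph_union_edgesP G1 G2 e :
  e \in edges G1 :|: edges G2 ->
  (e \subset vertices G1 :|: vertices G2) && (#|e| == 2).
Proof.
rewrite inE => /orP[] /edgesP /andP[sub ->]; rewrite andbT.
- exact: subset_trans sub (subsetUl _ _).
- exact: subset_trans sub (subsetUr _ _).
Qed.

Definition graph_union G1 G2 : graph T :=
  Graph (@graph_union_edgesP G1 G2).

(* The arc uv of the digraph D(G) is the ordered pair (u, v); no loop occurs
   since edges have exactly two elements. *)
Definition arcs G : {set T * T} := [set a | [set a.1; a.2] \in edges G].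

Definition adjacent_arcs : rel (T * T) := fun a b =>
  (a != b) && [|| a.1 == b.1, a.2 == b.1 | b.2 == a.1].

(* Colorings are defined on the arcs of G only (not on all pairs), so that a
   graph without edges has a coloring with the empty set of colors. *)
Definition arc_of G : finType := {a : T * T | a \in arcs G}.

Definition incidence_coloring G (C : finType) (s : arc_of G -> C) : bool :=
  [forall a, forall b, adjacent_arcs (val a) (val b) ==> (s a != s b)].

Definition incidence_colorable G (k : nat) : bool :=
  [exists s : {ffun arc_of G -> 'I_k}, incidence_coloring s].

Lemma incidence_coloring_colorable G (C : finType) (s : arc_of G -> C) :
  incidence_coloring s -> incidence_colorable G #|C|.
Proof.
move=> /forallP sP; apply/existsP; exists [ffun a => enum_rank (s a)].
apply/forallP => a; apply/forallP => b; rewrite !ffunE (inj_eq enum_rank_inj).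
exact: (forallP (sP a) b).
Qed.

Lemma incidence_colorable_exists G : exists k, incidence_colorable G k.
Proof.
exists #|arc_of G|; apply: (@incidence_coloring_colorable _ _ id).
apply/forallP => a; apply/forallP => b; apply/implyP => /andP[neq_ab _].
by apply: contraNneq neq_ab => ->.
Qed.

Definition incidence_chromatic_number G : nat :=
  ex_minn (incidence_colorable_exists G).

End Graph.

(* Main.v *)
(* Colour each arc inside one of the graphs containing it, using disjoint
   palettes: two arcs of the same colour then lie in the same [G_i]. *)

Require Import Defs.
From mathcomp Require Import all_boot.

(** Take optimal colorings of [G1] and [G2] with disjoint palettes. Every arc of the union is an arc
    of some [Gi] ([arcs_union]) and takes its color there. Adjacency depends only on endpoints, so
    adjacent arcs colored in the same [Gi] are already separated by its coloring. *)

Lemma incidence_chromatic_number_colorable (T : finType) (G : graph T) :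
  incidence_colorable G (incidence_chromatic_number G).
Proof. by rewrite /incidence_chromatic_number; case: ex_minnP. Qed.

Lemma incidence_chromatic_number_min (T : finType) (G : graph T) k :
  incidence_colorable G k -> incidence_chromatic_number G <= k.
Proof.
by rewrite /incidence_chromatic_number; case: ex_minnP => m _ min_m /min_m.
Qed.

Lemma incidence_coloringP (T : finType) (G : graph T) (C : finType)
    (s : arc_of G -> C) :
  reflect (forall a b, adjacent_arcs (val a) (val b) -> s a != s b)
          (incidence_coloring s).
Proof.
apply: (iffP forallP) => [sP a b | sP a]; first exact/implyP/(forallP (sP a)).
by apply/forallP => b; apply/implyP/sP.
Qed.

Lemma arcs_union (T : finType) (G1 G2 : graph T) :
  arcs (graph_union G1 G2) = arcs G1 :|: arcs G2.
Proof. by apply/setP => a; rewrite !inE. Qed.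

(** The tag records which graph colors the arc; an arc common to both graphs has two preimages. *)
Definition sum_arc (T : finType) (G1 G2 : graph T)
    (x : arc_of G1 + arc_of G2) : T * T :=
  match x with inl a => val a | inr a => val a end.

Lemma sum_arc_exists (T : finType) (G1 G2 : graph T)
    (a : arc_of (graph_union G1 G2)) :
  exists x : arc_of G1 + arc_of G2, sum_arc _ _ _ x == val a.
Proof.
case: a => a /=; rewrite arcs_union => /setUP[] aG.
- by exists (inl (Sub a aG)).
- by exists (inr (Sub a aG)).
Qed.

Theorem theorem4p1 (T : finType) (G1 G2 : graph T) :
  incidence_chromatic_number (graph_union G1 G2) <=
    incidence_chromatic_number G1 + incidence_chromatic_number G2.
Proof.
have /existsP[s1 /incidence_coloringP s1P] :=
  incidence_chromatic_number_colorable _ G1.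
have /existsP[s2 /incidence_coloringP s2P] :=
  incidence_chromatic_number_colorable _ G2.
apply: incidence_chromatic_number_min.
set k1 := incidence_chromatic_number G1 in s1 s1P *.
set k2 := incidence_chromatic_number G2 in s2 s2P *.
(* For a common arc, [xchoose] fixes one of the two tags; either would do. *)
pose s (a : arc_of (graph_union G1 G2)) : 'I_k1 + 'I_k2 :=
  match xchoose (sum_arc_exists _ _ _ a) with
  | inl b => inl (s1 b) | inr b => inr (s2 b)
  end.
have -> : k1 + k2 = #|{: 'I_k1 + 'I_k2}| by rewrite card_sum !card_ord.
apply: (@incidence_coloring_colorable _ _ _ s).
apply/incidence_coloringP => a b; rewrite /s.
move: (xchooseP (sum_arc_exists _ _ _ a)) (xchooseP (sum_arc_exists _ _ _ b)).
(* With different tags the colors lie in different summands, so only equal tags remain. *)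
case: (xchoose _) => a'; case: (xchoose _) => b' //= /eqP <- /eqP <- adj.
- by apply: contraNneq (s1P _ _ adj) => -[->].
- by apply: contraNneq (s2P _ _ adj) => -[->].
Qed.
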